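(* Let $\lambda$ be a singular cardinal of uncountable cofinality and let $\chi\le\operatorname{cf}(\lambda)$ be a cardinal. For every coloring $c:[\lambda^+]^2\to\lambda$ there exists a coloring $c^+:[\lambda^+]^2\to\lambda^+$ such that for every cardinal $\mu\le\lambda$ and every partition $p:[\lambda^+]^2\to\mu$: (1) if $c$ witnesses $\mathrm{pr}_1(\lambda^+,\lambda^+,\lambda,\chi)_p$ then $c^+$ witnesses $\mathrm{pr}_1(\lambda^+,\lambda^+,\lambda^+,\chi)_p$; (2) if $c$ witnesses $\mathrm{pr}_1(\lambda^+,\lambda^+\circledast\lambda^+,\lambda,\chi)_p$ then $c^+$ witnesses $\mathrm{pr}_1(\lambda^+,\lambda^+\circledast\lambda^+,\lambda^+,\chi)_p$.
   Context: $[\kappa]^2$ denotes the set of pairs $(\alpha,\beta)$ with $\alpha<\beta<\kappa$; a partition is any function $p:[\kappa]^2\to\mu$. For an ordinal $\sigma$, $[\kappa]^\sigma$ is the set of subsets of $\kappa$ of order type $\sigma$; $a<b$ means every element of $a$ is below every element of $b$. Given $p:[\kappa]^2\to\mu$, a coloring $c:[\kappa]^2\to\theta$ witnesses $\mathrm{pr}_1(\kappa,\kappa,\theta,\chi)_p$ iff for every ordinal $\sigma<\chi$, every pairwise disjoint $\mathcal A\subseteq[\kappa]^\sigma$ of size $\kappa$ and every $\tau:\mu\to\theta$ there are $a,b\in\mathcal A$, $a<b$, with $c(\alpha,\beta)=\tau(p(\alpha,\beta))$ for all $\alpha\in a,\beta\in b$. It witnesses $\mathrm{pr}_1(\kappa,\kappa\circledast\kappa,\theta,\chi)_p$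 iff for every ordinal $\sigma<\chi$ and every two families $\mathcal A,\mathcal B\subseteq[\kappa]^\sigma$, each pairwise disjoint and of size $\kappa$, there is $\mathcal A'\subseteq\mathcal A$ of size $\kappa$ such that for every $\tau:\mu\to\theta$ there are $a\in\mathcal A'$, $b\in\mathcal B$, $a<b$, with $c(\alpha,\beta)=\tau(p(\alpha,\beta))$ for all $\alpha\in a,\beta\in b$. *)

(* Defs.v *)
(* A (strict) well-ordered type; an ordinal is the order type of such a type. *)
Record WO := {
  wo_car :> Type;
  wo_lt : wo_car -> wo_car -> Prop;
  wo_wf : well_founded wo_lt;
  wo_trans : forall x y z, wo_lt x y -> wo_lt y z -> wo_lt x z;
  wo_total : forall x y, wo_lt x y \/ x = y \/ wo_lt y x
}.
Arguments wo_lt {w} _ _.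

Definition injects (A B : Type) : Prop :=
  exists f : A -> B, forall x y, f x = f y -> x = y.

Definition bijects (A B : Type) : Prop :=
  exists f : A -> B, (forall x y, f x = f y -> x = y) /\ (forall y, exists x, f x = y).

Definition below (K : WO) (t : K) : Type := {x : K | wo_lt x t}.

Definition is_cardinal (K : WO) : Prop :=
  forall t : K, ~ injects K (below K t).

Definition cofinal (K : WO) (C : K -> Prop) : Prop :=
  forall x : K, exists y, C y /\ (x = y \/ wo_lt x y).

Definition singular (K : WO) : Prop :=
  is_cardinal K /\ injects nat K /\
  exists C : K -> Prop, cofinal K C /\ ~ injects K {x : K | C x}.

Definition uncountable_cof (K : WO) : Prop :=
  forall C : K -> Prop, cofinal K C -> ~ injects {x : K | C x} nat.

Definition le_cf (X K : WO) : Prop :=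
  forall C : K -> Prop, cofinal K C -> injects X {x : K | C x}.

Definition is_succ_card (K Kp : WO) : Prop :=
  is_cardinal Kp /\ ~ injects Kp K /\ forall t : Kp, injects (below Kp t) K.

(* the subset a of K has order type sigma, where sigma is the ordinal
   (of the initial segment) below s in X *)
Definition has_otp (K X : WO) (a : K -> Prop) (s : X) : Prop :=
  exists f : below X s -> {x : K | a x},
    (forall x y, f x = f y -> x = y) /\ (forall y, exists x, f x = y) /\
    (forall x y : below X s, wo_lt (proj1_sig x) (proj1_sig y) ->
        wo_lt (proj1_sig (f x)) (proj1_sig (f y))).

Definition set_lt (K : WO) (a b : K -> Prop) : Prop :=
  forall x y, a x -> b y -> wo_lt x y.

Definition good_family (K X : WO) (s : X) (A : (K -> Prop) -> Prop) : Prop :=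
  (forall a, A a -> has_otp K X a s) /\
  (forall a b, A a -> A b -> a <> b -> forall x, ~ (a x /\ b x)) /\
  bijects K {a : K -> Prop | A a}.

(* colorings/partitions [K]^2 -> Th are functions K -> K -> Th,
   only their values at (alpha, beta) with alpha < beta matter *)
Definition pr1 (K : WO) (Th : Type) (X : WO) (M : Type)
  (p : K -> K -> M) (c : K -> K -> Th) : Prop :=
  forall (s : X) (A : (K -> Prop) -> Prop), good_family K X s A ->
  forall tau : M -> Th,
  exists a b, A a /\ A b /\ set_lt K a b /\
    forall al be, a al -> b be -> c al be = tau (p al be).

Definition pr1_circ (K : WO) (Th : Type) (X : WO) (M : Type)
  (p : K -> K -> M) (c : K -> K -> Th) : Prop :=
  forall (s : X) (A B : (K -> Prop) -> Prop),
  good_family K X s A -> good_family K X s B ->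
  exists A' : (K -> Prop) -> Prop,
    (forall a, A' a -> A a) /\ bijects K {a : K -> Prop | A' a} /\
    forall tau : M -> Th,
    exists a b, A' a /\ B b /\ set_lt K a b /\
      forall al be, a al -> b be -> c al be = tau (p al be).

(* Main.v *)
(* Fix surjections e_d from L onto each d < Lp, and decode c(al,be) as a triple (i,j,eps).
   Then c+(al,be) = e_g(eps) with g = e_d(j), where d is the least point above al of a set
   C(be,i) of size less than L attached to be and i. If all values of tau lie below some g,
   it suffices to thin the given families so that d varies with b only and e_d(j) = g for
   suitable fixed i and j, for then c can be asked to take the value (i, j, e_g^-1(tau)).

   The sets C(be,i) collect the sets C_d of a club guessing sequence, for d = e_be(j) with
   j < i: every club E meets some C_d in points of arbitrarily large cofinality below L.
   If all elements of b lie above that d, then, b having fewer than cf(L) elements, one i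
   puts C_d inside C(be,i) for all be in b, and a point d' of C_d in E of cofinality larger
   than the sets C(be,i) is not a limit of their union. So d' is the least point of C(be,i)
   above al for all al < d' large enough, uniformly in b, and the set of such d' is
   stationary. Club guessing follows Shelah: were it to fail, omega many successive
   corrections of the club would have a limit contradicting all of them; this is where
   cf(L) > omega enters.

   Clubs are represented by the sets of closure points of functions h : Lp -> Lp. *)
From Stdlib Require Import ClassicalEpsilon FunctionalExtensionality PropExtensionality.
From Stdlib Require Import Wellfounded List Cantor Lia.
Require Import Defs.

(** * Choice, injections and the Cantor-Bernstein theorem *)

Lemma choice (A B : Type) (R : A -> B -> Prop) :
  (forall x, exists y, R x y) -> exists f : A -> B, forall x, R x (f x).
Proof.
  intros H.
  exists (fun x => proj1_sig (constructive_indefinite_description _ (H x))).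
  intros x; exact (proj2_sig (constructive_indefinite_description _ (H x))).
Qed.

Lemma sig_eq {A : Type} {P : A -> Prop} (u v : {x | P x}) :
  proj1_sig u = proj1_sig v -> u = v.
Proof.
  destruct u as [x p], v as [y q]; simpl; intros ->.
  f_equal; apply proof_irrelevance.
Qed.

Lemma injects_trans (A B C : Type) : injects A B -> injects B C -> injects A C.
Proof.
  intros [f Hf] [g Hg]; exists (fun x => g (f x)); auto.
Qed.

Lemma injects_of_rel (A B : Type) (R : A -> B -> Prop) :
  (forall x, exists y, R x y) ->
  (forall x x' y, R x y -> R x' y -> x = x') -> injects A B.
Proof.
  intros H1 H2; destruct (choice _ _ R H1) as [f Hf]; exists f.
  intros x y E; apply (H2 x y (f x)); auto; rewrite E; auto.
Qed.

Lemma injects_prod (A B C D : Type) :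
  injects A B -> injects C D -> injects (A * C) (B * D).
Proof.
  intros [f Hf] [g Hg]; exists (fun u => (f (fst u), g (snd u))).
  intros [a b] [a' b'] E; injection E; simpl; intros.
  f_equal; auto.
Qed.

Lemma injects_sub (A : Type) (P Q : A -> Prop) :
  (forall x, P x -> Q x) -> injects {x | P x} {x | Q x}.
Proof.
  intros H; exists (fun u => exist _ (proj1_sig u) (H _ (proj2_sig u))).
  intros u v E; apply sig_eq; exact (f_equal (@proj1_sig _ _) E).
Qed.

Lemma injects_sig (A : Type) (P : A -> Prop) : injects {x | P x} A.
Proof. exists (@proj1_sig _ _); intros u v; apply sig_eq. Qed.

(** Cantor-Bernstein: [P] consists of the points that can be traced back along [g] after [f] to a
    point outside the range of [g]. The bijection is [f] on [P] and the inverse of [g] off [P]. *)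
Theorem injects_antisym (A B : Type) : injects A B -> injects B A -> bijects A B.
Proof.
  intros [f Hf] [g Hg].
  pose (fix orb n x := match n with
        | 0 => forall y, x <> g y
        | S n => exists y, x = g (f y) /\ orb n y end) as orb.
  pose (fun x => exists n, orb n x) as P.
  assert (HP : forall x, P x -> P (g (f x))).
  { intros x [n Hn]; exists (S n), x; auto. }
  assert (HN : forall x, ~ P x -> exists y, x = g y).
  { intros x Hx; apply NNPP; intros H; apply Hx; exists 0.
    intros y E; apply H; eauto. }
  assert (HQ : forall x, exists y, (P x /\ y = f x) \/ (~ P x /\ x = g y)).
  { intros x; destruct (classic (P x)) as [H|H]; eauto.
    destruct (HN x H) as [y Hy]; eauto. }
  destruct (choice _ _ _ HQ) as [h Hh]; exists h; split.
  - intros x y E.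
    destruct (Hh x) as [[p e]|[p e]], (Hh y) as [[q e']|[q e']].
    + apply Hf; congruence.
    + exfalso; apply q; rewrite e', <- E, e; auto.
    + exfalso; apply p; rewrite e, E, e'; auto.
    + congruence.
  - intros y; destruct (classic (P (g y))) as [[[|n] Hn]|H].
    + exfalso; apply (Hn y); auto.
    + destruct Hn as [x [e Hx]]; apply Hg in e; exists x.
      destruct (Hh x) as [[_ E]|[q _]]; [congruence|].
      exfalso; apply q; exists n; auto.
    + exists (g y); destruct (Hh (g y)) as [[p _]|[_ e]]; [contradiction|auto].
Qed.

(** * Well-orders *)

Definition le {W : WO} (x y : W) : Prop := ~ wo_lt y x.

Lemma lt_irrefl (W : WO) (x : W) : ~ wo_lt x x.
Proof.
  intros H; induction (wo_wf W x) as [x _ IH]; exact (IH x H H).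
Qed.

Lemma lt_le {W : WO} (x y : W) : wo_lt x y -> le x y.
Proof. intros H K; exact (lt_irrefl W x (wo_trans W _ _ _ H K)). Qed.

Lemma le_refl {W : WO} (x : W) : le x x.
Proof. exact (lt_irrefl W x). Qed.

Lemma le_or_lt {W : WO} (x y : W) : le x y \/ wo_lt y x.
Proof. unfold le; destruct (classic (wo_lt y x)); auto. Qed.

Lemma le_cases {W : WO} (x y : W) : le x y -> x = y \/ wo_lt x y.
Proof. intros H; destruct (wo_total W x y) as [|[|]]; auto; contradiction. Qed.

Lemma le_lt_trans {W : WO} (x y z : W) : le x y -> wo_lt y z -> wo_lt x z.
Proof.
  intros H K; destruct (le_cases _ _ H) as [->|H']; auto.
  exact (wo_trans W _ _ _ H' K).
Qed.

Lemma lt_le_trans {W : WO} (x y z : W) : wo_lt x y -> le y z -> wo_lt x z.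
Proof.
  intros H K; destruct (le_cases _ _ K) as [<-|K']; auto.
  exact (wo_trans W _ _ _ H K').
Qed.

Lemma le_trans {W : WO} (x y z : W) : le x y -> le y z -> le x z.
Proof.
  intros H K N; apply H; exact (le_lt_trans _ _ _ K N).
Qed.

Lemma le_antisym {W : WO} (x y : W) : le x y -> le y x -> x = y.
Proof. intros H K; destruct (le_cases _ _ H); auto; contradiction. Qed.

Lemma wo_least (W : WO) (P : W -> Prop) :
  (exists x, P x) -> exists x, P x /\ forall y, P y -> le x y.
Proof.
  intros [x Hx]; apply NNPP; intros N.
  induction (wo_wf W x) as [x _ IH]; apply N; exists x; split; auto.
  intros y Hy K; exact (IH y K Hy).
Qed.

Lemma wo_max (W : WO) (x y : W) : exists z, le x z /\ le y z /\ (z = x \/ z = y).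
Proof.
  destruct (le_or_lt x y) as [H|H].
  - exists y; auto using le_refl.
  - exists x; auto using le_refl, lt_le.
Qed.

(** Transparent, like [lexWO], because later proofs compute with the order it defines. *)
Definition imgWO (T : Type) (W : WO) (f : T -> W)
  (Hf : forall x y, f x = f y -> x = y) : WO.
Proof.
  refine (Build_WO T (fun x y => wo_lt (f x) (f y)) _ _ _).
  - apply wf_inverse_image; apply wo_wf.
  - intros x y z; apply wo_trans.
  - intros x y; destruct (wo_total W (f x) (f y)) as [|[|]]; auto.
Defined.

Definition subWO (W : WO) (P : W -> Prop) : WO :=
  imgWO {x | P x} W (@proj1_sig _ _) sig_eq.

Definition lexWO (V W : WO) : WO.
Proof.
  refine (Build_WO (V * W)
    (fun u v => wo_lt (fst u) (fst v) \/ fst u = fst v /\ wo_lt (snd u) (snd v)) _ _ _).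
  - intros [a b]; revert b.
    induction (wo_wf V a) as [a _ IHa]; intros b.
    induction (wo_wf W b) as [b _ IHb].
    constructor; intros [a' b']; simpl; intros [H|[-> H]]; auto.
  - intros [a b] [a' b'] [a'' b'']; simpl.
    intros [H|[-> H]] [K|[E K]]; try subst; eauto using wo_trans.
  - intros [a b] [a' b']; simpl.
    destruct (wo_total V a a') as [|[->|]]; auto.
    destruct (wo_total W b b') as [|[->|]]; auto.
Defined.

(** Transfinite recursion sends each point of [A] to a value in [B] not taken earlier, or to [None]
    once there is none. If [None] occurs at [t], every element of [B] was taken below [t]; otherwise
    the recursion is an injection. *)
Theorem injects_or_initial (A : WO) (B : Type) :
  injects A B \/ exists t : A, injects B (below A t).
Proof.
  pose (F (a : A) (rec : forall a', wo_lt a' a -> option B) :=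
    match excluded_middle_informative (exists b, forall a' H, rec a' H <> Some b) with
    | left h => Some (proj1_sig (constructive_indefinite_description _ h))
    | right _ => None
    end).
  pose (f := Fix (wo_wf A) (fun _ => option B) F).
  assert (Hf : forall a, f a = F a (fun a' _ => f a')).
  { intros a; unfold f; rewrite Fix_eq; auto.
    intros x g g' E; f_equal; extensionality y; extensionality p; auto. }
  assert (HS : forall a b, f a = Some b -> forall a', wo_lt a' a -> f a' <> Some b).
  { intros a b E a' H; rewrite Hf in E; unfold F in E.
    destruct excluded_middle_informative as [h|h]; [|discriminate].
    injection E as <-; destruct constructive_indefinite_description as [b Hb]; simpl.
    auto. }
  destruct (classic (exists t, f t = None)) as [[t Ht]|N].
  - right; exists t.
    rewrite Hf in Ht; unfold F in Ht.
    destruct excluded_middle_informative as [|h]; [discriminate|].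
    apply injects_of_rel with (R := fun b u => f (proj1_sig u) = Some b).
    + intros b; apply NNPP; intros K; apply h; exists b; intros a' H E.
      apply K; exists (exist _ a' H); exact E.
    + intros x x' y; congruence.
  - left; apply injects_of_rel with (R := fun a b => f a = Some b).
    + intros a; destruct (f a) eqn:E; eauto; destruct N; eauto.
    + intros x y b Ex Ey; destruct (wo_total A x y) as [H|[H|H]]; auto; exfalso.
      * exact (HS _ _ Ey _ H Ex).
      * exact (HS _ _ Ex _ H Ey).
Qed.

(** * Cardinal squares *)

(* Goedel's ordering: pairs are compared by their maximum first, so that the
   predecessors of a pair all lie in the square of a proper initial segment. *)
Lemma injects_square_step (W : WO) :
  injects nat W ->
  (forall t : W, injects nat (below W t) ->
     injects (below W t * below W t) (below W t)) ->
  injects (W * W) W.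
Proof.
  intros Hinf IH.
  destruct (classic (exists t, injects W (below W t))) as [[t Ht]|Hcard].
  { apply injects_trans with (1 := injects_prod _ _ _ _ Ht Ht).
    apply injects_trans with (below W t); [|apply injects_sig].
    apply IH; exact (injects_trans _ _ _ Hinf Ht). }
  destruct (injects_or_initial W nat) as [Hn|[t0 Ht0]].
  { apply injects_trans with (1 := injects_prod _ _ _ _ Hn Hn).
    apply injects_trans with nat; auto.
    exists to_nat; intros x y E.
    rewrite <- (cancel_of_to x), <- (cancel_of_to y); congruence. }
  destruct (choice (W * W) W
    (fun u z => le (fst u) z /\ le (snd u) z /\ (z = fst u \/ z = snd u)))
    as [mx Hmx].
  { intros u; apply wo_max. }
  pose (G := imgWO (W * W) (lexWO W (lexWO W W)) (fun u => (mx u, u))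
    (fun x y E => f_equal snd E)).
  (* Otherwise [W] injects into a proper initial segment of [G], hence into the square of the set of
     points up to [m], which is no larger than [below W m] by [IH]; this contradicts [Hcard]. Taking
     [m] above [t0] makes [IH] applicable. *)
  destruct (injects_or_initial G W) as [H|[t Ht]]; [exact H|exfalso].
  destruct (wo_max W (mx t) t0) as [m [Hm1 [Hm2 _]]].
  assert (Hm : injects nat (below W m)).
  { apply injects_trans with (1 := Ht0); apply injects_sub.
    intros x Hx; exact (lt_le_trans _ _ _ Hx Hm2). }
  pose proof (IH m Hm) as Hsq.
  (* The extra point [m] is absorbed by the square, with [n 0] and [n 1] as tags. *)
  assert (Hle : injects {x : W | le x m} (below W m)).
  { refine (injects_trans _ _ _ _ Hsq).
    destruct Hm as [n Hn].
    apply injects_of_rel with (R := fun (x : {x : W | le x m}) (u : below W m * below W m) =>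
      (fst u = n 0 /\ proj1_sig x = proj1_sig (snd u)) \/
      (fst u = n 1 /\ proj1_sig x = m)).
    - intros [x Hx]; destruct (le_cases _ _ Hx) as [E|H].
      + exists (n 1, n 1); simpl; auto.
      + exists (n 0, exist _ x H); simpl; auto.
    - intros x x' [u v]; simpl; intros [[E F]|[E F]] [[E' F']|[E' F']];
        try (apply sig_eq; congruence);
        exfalso; assert (X : 0 = 1) by (apply Hn; congruence); discriminate. }
  apply Hcard; exists m.
  apply injects_trans with (1 := Ht).
  refine (injects_trans _ _ _ _ (injects_trans _ _ _ (injects_prod _ _ _ _ Hle Hle) Hsq)).
  apply injects_of_rel with (R := fun (u : below G t) (v : {x : W | le x m} * {x : W | le x m}) =>
      proj1_sig u = (proj1_sig (fst v), proj1_sig (snd v))).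
  - intros [[a b] H]; simpl in *.
    assert (Hle2 : le (mx (a, b)) m).
    { destruct H as [H|[E _]]; simpl in *.
      - exact (le_trans _ _ _ (lt_le _ _ H) Hm1).
      - rewrite E; exact Hm1. }
    destruct (Hmx (a, b)) as [Ha [Hb _]]; simpl in *.
    exists (exist _ a (le_trans _ _ _ Ha Hle2), exist _ b (le_trans _ _ _ Hb Hle2)).
    reflexivity.
  - intros x x' v E E'; apply sig_eq; congruence.
Qed.

(** The segment below [t] is a well-order of its own, to which the step applies; [H1] and [H2] match
    its initial segments with those of [W]. *)
Lemma injects_square_below (W : WO) (t : W) :
  injects nat (below W t) -> injects (below W t * below W t) (below W t).
Proof.
  induction (wo_wf W t) as [t _ IH]; intros Hinf.
  apply (injects_square_step (subWO W (fun x => wo_lt x t))); auto.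
  intros [u Hu] Hn.
  assert (H1 : injects (below (subWO W (fun x => wo_lt x t)) (exist _ u Hu)) (below W u)).
  { apply injects_of_rel with (R := fun x y => proj1_sig (proj1_sig x) = proj1_sig y).
    - intros [[x Hx] Hxu]; exists (exist _ x Hxu); reflexivity.
    - intros x x' y E E'; apply sig_eq, sig_eq; exact (eq_trans E (eq_sym E')). }
  assert (H2 : injects (below W u) (below (subWO W (fun x => wo_lt x t)) (exist _ u Hu))).
  { apply injects_of_rel with (R := fun y x => proj1_sig (proj1_sig x) = proj1_sig y).
    - intros [x Hx].
      exists (exist _ (exist _ x (wo_trans _ _ _ _ Hx Hu)) Hx); reflexivity.
    - intros x x' y E E'; apply sig_eq; exact (eq_trans (eq_sym E) E'). }
  apply injects_trans with (1 := injects_prod _ _ _ _ H1 H1).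
  refine (injects_trans _ _ _ (IH u Hu _) H2).
  exact (injects_trans _ _ _ Hn H1).
Qed.

Theorem injects_square (W : WO) : injects nat W -> injects (W * W) W.
Proof.
  intros H; apply injects_square_step; auto; intros t; apply injects_square_below.
Qed.

(** A list is coded by its iterated pairing together with its length, since the pairing alone does
    not tell where the list ends. *)
Lemma injects_lists (T : Type) :
  injects nat T -> injects (T * T) T -> injects (list T) T.
Proof.
  intros Hn [f Hf].
  apply injects_trans with (nat * T)%type.
  - destruct (Hn) as [n _].
    pose (enc := fold_right (fun x y => f (x, y)) (n 0)).
    exists (fun l => (length l, enc l)); unfold enc.
    intros l; induction l as [|a l IH]; intros [|b m] E; try discriminate E; auto.
    injection E as E1 E2; apply Hf in E2; injection E2 as -> E2.
    f_equal; apply IH; congruence.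
  - refine (injects_trans _ _ _ (injects_prod _ _ _ _ Hn _) (ex_intro _ f Hf)).
    exists (fun x => x); auto.
Qed.

Lemma injects_lists_below (W : WO) (t : W) :
  injects nat (below W t) -> injects (list (below W t)) (below W t).
Proof.
  intros H; apply injects_lists; auto using injects_square_below.
Qed.

(** * Closure points and cofinalities *)

Lemma injects_option (T : Type) : injects nat T -> injects (T * T) T -> injects (option T) T.
Proof.
  intros H1 H2; apply injects_trans with (list T); [|apply injects_lists; auto].
  exists (fun o => match o with Some x => x :: nil | None => nil end).
  intros [x|] [y|] E; congruence.
Qed.

Lemma injects_le_option (W : WO) (P : W -> Prop) (x : W) :
  injects {y | P y /\ le y x} (option {y | P y /\ wo_lt y x}).
Proof.
  apply injects_of_rel with (R := fun u o =>
    match o with Some v => proj1_sig u = proj1_sig v | None => proj1_sig u = x end).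
  - intros [y [Hy Hl]]; destruct (le_cases _ _ Hl) as [E|H].
    + exists None; auto.
    + exists (Some (exist _ y (conj Hy H))); reflexivity.
  - intros u v [w|] E E'; apply sig_eq; congruence.
Qed.

(** Total maps allow a whole family of such injections to be picked by [choice] at a single type. *)
Lemma injection_on (A B : Type) (P : A -> Prop) (b : B) : injects {x | P x} B ->
  exists f : A -> B, forall x y, P x -> P y -> f x = f y -> x = y.
Proof.
  intros [f Hf].
  destruct (choice A B (fun x y => forall p : P x, y = f (exist _ x p))) as [g Hg].
  - intros x; destruct (classic (P x)) as [p|p].
    + exists (f (exist _ x p)); intros q; f_equal; apply sig_eq; reflexivity.
    + exists b; intros q; contradiction.
  - exists g; intros x y p q E; rewrite (Hg x p), (Hg y q) in E.
    apply Hf in E; congruence.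
Qed.

Lemma bounded_of_not_cofinal_range (K : WO) (I : Type) (f : I -> K) :
  ~ cofinal K (fun y => exists i, f i = y) -> exists k, forall i, wo_lt (f i) k.
Proof.
  intros H; apply NNPP; intros N; apply H; intros x.
  apply NNPP; intros M; apply N; exists x; intros i.
  destruct (le_or_lt x (f i)) as [K1|K1]; auto.
  exfalso; apply M; exists (f i); split; eauto.
  destruct (le_cases _ _ K1); auto.
Qed.

Lemma injects_range (I K : Type) (f : I -> K) : injects {y | exists i, f i = y} I.
Proof.
  apply injects_of_rel with (R := fun u i => f i = proj1_sig u).
  - intros [y [i E]]; eauto.
  - intros u v i E E'; apply sig_eq; congruence.
Qed.

(** Bounds in [L] are enlarged in this way so that squares and lists over the segment do not raise
    its size. [L] is uncountable, being cofinal in itself. *)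
Lemma exists_infinite_below (L : WO) : injects nat L -> uncountable_cof L ->
  forall k : L, exists k', le k k' /\ injects nat (below L k').
Proof.
  intros Hn Hu k.
  destruct (injects_or_initial L nat) as [H|[t Ht]].
  - exfalso; apply (Hu (fun _ => True)).
    + intros x; exists x; auto.
    + exact (injects_trans _ _ _ (injects_sig _ _) H).
  - destruct (wo_max L k t) as [z [H1 [H2 _]]]; exists z; split; auto.
    apply injects_trans with (1 := Ht), injects_sub.
    intros x Hx; exact (lt_le_trans _ _ _ Hx H2).
Qed.

(** For [W] the successor cardinal of [L], this is regularity of [W]. *)
Definition families_bounded (L W : WO) : Prop :=
  forall I : Type, injects I L -> forall f : I -> W, exists x, forall i, wo_lt (f i) x.

(** If the [f i] were unbounded, each [x] would be determined by some [i] with [x] below [f i] and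
    by its place in an enumeration of the segment below [f i], so [Lp] would inject into [L * L]. *)
Lemma succ_card_families_bounded (L Lp : WO) :
  injects nat L -> is_succ_card L Lp -> families_bounded L Lp.
Proof.
  intros Hn [_ [Hs Hb]] I HI f.
  pose proof (injects_square L Hn) as Hsq.
  apply NNPP; intros N; apply Hs.
  refine (injects_trans _ _ _ _ Hsq).
  (* As there is no last point, every [x] can be put strictly below some [f i]. *)
  assert (Hsucc : forall x : Lp, exists y, wo_lt x y).
  { intros x; apply NNPP; intros M; apply Hs.
    refine (injects_trans _ _ _ _ (injects_option L Hn Hsq)).
    destruct (Hb x) as [g Hg].
    apply injects_of_rel with (R := fun y o =>
      match o with Some l => exists u, proj1_sig u = y /\ g u = l | None => y = x end).
    - intros y; destruct (wo_total Lp y x) as [H|[H|H]].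
      + exists (Some (g (exist _ y H))), (exist _ y H); auto.
      + exists None; auto.
      + exfalso; apply M; eauto.
    - intros y y' [l|]; [|congruence].
      intros [u [E1 E2]] [v [E3 E4]]; rewrite <- E1, <- E3; f_equal.
      apply Hg; congruence. }
  destruct (choice Lp Lp _ Hsucc) as [s Hsu].
  assert (HF : forall x, exists i, wo_lt x (f i)).
  { intros x; apply NNPP; intros M; apply N; exists (s x); intros i.
    destruct (le_or_lt (s x) (f i)) as [H|H]; auto.
    exfalso; apply M; exists i; exact (lt_le_trans _ _ _ (Hsu x) H). }
  destruct (choice _ _ _ HF) as [ix Hix]; destruct HI as [gi Hgi].
  assert (HC : forall t : Lp, exists c : Lp -> L,
    forall x y, wo_lt x t -> wo_lt y t -> c x = c y -> x = y).
  { intros t; destruct Hn as [n _]; exact (injection_on _ _ _ (n 0) (Hb t)). }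
  destruct (choice _ _ _ HC) as [c Hcc].
  exists (fun x => (gi (ix x), c (f (ix x)) x)); intros x y E.
  injection E as E1 E2; apply Hgi in E1.
  apply (Hcc (f (ix x))); auto; [rewrite E1; auto|congruence].
Qed.

Definition closed_under {W : WO} (h : W -> W) (d : W) : Prop :=
  forall x, wo_lt x d -> wo_lt (h x) d.

Lemma closed_under_mono (W : WO) (h h' : W -> W) (d : W) :
  (forall x, le (h x) (h' x)) -> closed_under h' d -> closed_under h d.
Proof. intros H K x Hx; exact (le_lt_trans _ _ _ (H x) (K x Hx)). Qed.

(** [d] is the supremum of the iterates of a map [g] bounding [h] on segments: a point at or below
    [u n] has its value under [h] below [u (S (S n))]. *)
Lemma closed_under_unbounded (L Lp : WO) :
  injects nat L -> is_succ_card L Lp ->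
  forall (h : Lp -> Lp) (x : Lp), exists d, wo_lt x d /\ closed_under h d.
Proof.
  intros Hn Hs h x.
  pose proof (succ_card_families_bounded L Lp Hn Hs) as Hr.
  assert (HG : forall x : Lp, exists y, wo_lt x y /\ forall z, wo_lt z x -> wo_lt (h z) y).
  { intros z.
    destruct (Hr (below Lp z) (proj2 (proj2 Hs) z) (fun u => h (proj1_sig u))) as [y1 H1].
    destruct (Hr nat Hn (fun _ => z)) as [y2 H2].
    destruct (wo_max Lp y1 y2) as [y [K1 [K2 _]]].
    exists y; split; [exact (lt_le_trans _ _ _ (H2 0) K2)|].
    intros w Hw; exact (lt_le_trans _ _ _ (H1 (exist _ w Hw)) K1). }
  destruct (choice _ _ _ HG) as [g Hg].
  pose (u := fun n => Nat.iter n g x).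
  destruct (wo_least Lp (fun d => forall n, wo_lt (u n) d) (Hr nat Hn u)) as [d [Hd Hmin]].
  exists d; split; [exact (Hd 0)|].
  intros y Hy.
  assert (K : exists n, le y (u n)).
  { apply NNPP; intros N; apply (Hmin y); auto; intros n.
    destruct (le_or_lt y (u n)); auto; exfalso; eauto. }
  destruct K as [n K].
  apply wo_trans with (2 := Hd (S (S n))).
  apply (proj2 (Hg (u (S n)))).
  exact (le_lt_trans _ _ _ K (proj1 (Hg (u n)))).
Qed.

(** The supremum of the closed points up to [g] is again closed. *)
Lemma closed_under_max (W : WO) (h : W -> W) (g : W) :
  exists m, closed_under h m /\ le m g /\
    forall z, closed_under h z -> le z g -> le z m.
Proof.
  destruct (wo_least W (fun y => forall z, closed_under h z -> le z g -> le z y))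
    as [m [H1 H2]].
  { exists g; auto. }
  exists m; split; [|split; auto].
  intros x Hx; apply NNPP; intros N; apply (H2 x); auto.
  intros z Hz Hzg K; apply N.
  exact (lt_le_trans _ _ _ (Hz x K) (H1 z Hz Hzg)).
Qed.

(* The cofinality of [d] exceeds [k]; the strict bound [x] makes this false at [0]
   and, for [k] nonzero, at successors. *)
Definition cof_gt {L Lp : WO} (k : L) (d : Lp) : Prop :=
  forall f : L -> Lp, exists x, wo_lt x d /\
    forall y, wo_lt y k -> wo_lt (f y) d -> wo_lt (f y) x.

Lemma cof_gt_mono (L Lp : WO) (k k' : L) (d : Lp) :
  le k k' -> cof_gt k' d -> cof_gt k d.
Proof.
  intros H K f; destruct (K f) as [x [Hx Hy]]; exists x; split; auto.
  intros y Hyk; apply Hy; exact (lt_le_trans _ _ _ Hyk H).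
Qed.

Lemma cof_gt_family (L Lp : WO) (k : L) (d : Lp) (I : Type) (f : I -> Lp) :
  cof_gt k d -> injects I (below L k) ->
  exists x, wo_lt x d /\ forall i, wo_lt (f i) d -> wo_lt (f i) x.
Proof.
  intros H [g Hg].
  destruct (choice L Lp (fun y z => forall i, proj1_sig (g i) = y -> z = f i)) as [F HF].
  - intros y; destruct (classic (exists i, proj1_sig (g i) = y)) as [[i E]|N].
    + exists (f i); intros j Ej; f_equal; apply Hg, sig_eq; congruence.
    + exists d; intros i E; exfalso; eauto.
  - destruct (H F) as [x [Hx Hy]]; exists x; split; auto.
    intros i Hi; rewrite <- (HF _ i eq_refl) in *.
    apply Hy; auto; exact (proj2_sig (g i)).
Qed.

(** Take the least [d] with more closed points below it than [below L k] has elements. If [d] were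
    the limit of a family indexed below [k], these closed points would be covered by [k] many sets
    of size at most that of [k], and so would be too few. *)
Lemma exists_cof_gt (L Lp : WO) :
  is_cardinal L -> injects nat L -> uncountable_cof L -> is_succ_card L Lp ->
  forall (h : Lp -> Lp) (k : L), exists d, closed_under h d /\ cof_gt k d.
Proof.
  intros Hc Hn Hu Hs h k0.
  destruct (exists_infinite_below L Hn Hu k0) as [k [Hk0 Hk]].
  pose proof (injects_square_below L k Hk) as Hsq.
  pose (E := fun d x : Lp => closed_under h x /\ wo_lt x d).
  (* Otherwise the club either injects into [L], and is bounded, or has a proper segment into which
     [L] injects, although [L] does not inject into [below L k]. *)
  assert (HP : exists d, ~ injects {x | E d x} (below L k)).
  { apply NNPP; intros N.
    destruct (injects_or_initial (subWO Lp (closed_under h)) L) as [H|[t Ht]].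
    - destruct (succ_card_families_bounded L Lp Hn Hs _ H (@proj1_sig _ _)) as [x Hx].
      destruct (closed_under_unbounded L Lp Hn Hs h x) as [d [H1 H2]].
      exact (lt_le d x (Hx (exist _ d H2)) H1).
    - apply (Hc k).
      apply injects_trans with (1 := Ht).
      apply NNPP; intros M; apply N; exists (proj1_sig t); intros K; apply M.
      refine (injects_trans _ _ _ _ K).
      apply injects_of_rel with (R := fun u v => proj1_sig (proj1_sig u) = proj1_sig v).
      + intros [[x Hx] Hxt]; exists (exist _ x (conj Hx Hxt)); reflexivity.
      + intros x x' y e e'; apply sig_eq, sig_eq; exact (eq_trans e (eq_sym e')). }
  destruct (wo_least Lp _ HP) as [d [Hd Hmin]].
  assert (Hlow : forall x, wo_lt x d -> injects {y | E x y} (below L k)).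
  { intros x Hx; apply NNPP; intros N; exact (Hmin x N Hx). }
  (* One further point does not change an infinite size, so there is no last closed point below
     [d]. *)
  assert (Hlim : forall x, wo_lt x d -> exists z, closed_under h z /\ wo_lt x z /\ wo_lt z d).
  { intros x Hx; apply NNPP; intros N; apply Hd.
    apply injects_trans with {y | closed_under h y /\ le y x}.
    { apply injects_sub; intros y [H1 H2]; split; auto.
      intros H3; apply N; eauto. }
    apply injects_trans with (1 := injects_le_option _ _ _).
    apply injects_trans with (2 := injects_option _ Hk Hsq).
    destruct (Hlow x Hx) as [f Hf].
    exists (option_map f); intros [u|] [v|] e; try discriminate; auto.
    injection e as e; f_equal; auto. }
  exists d; split.
  { intros x Hx; destruct (Hlim x Hx) as [z [H1 [H2 H3]]].
    exact (wo_trans _ _ _ _ (H1 x H2) H3). }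
  apply cof_gt_mono with (1 := Hk0).
  intros f; apply NNPP; intros N; apply Hd.
  apply injects_trans with (2 := Hsq).
  destruct Hk as [n0 _].
  assert (HC : forall u : Lp, exists c : Lp -> below L k,
    wo_lt u d -> forall x y, E u x -> E u y -> c x = c y -> x = y).
  { intros u; destruct (classic (wo_lt u d)) as [H|H].
    - destruct (injection_on _ _ _ (n0 0) (Hlow u H)) as [c Hcc]; eauto.
    - exists (fun _ => n0 0); contradiction. }
  destruct (choice _ _ _ HC) as [c Hcc].
  apply injects_of_rel with (R := fun x (u : below L k * below L k) =>
    let z := f (proj1_sig (fst u)) in
    wo_lt z d /\ wo_lt (proj1_sig x) z /\ snd u = c z (proj1_sig x)).
  - intros [x [H1 H2]]; destruct (Hlim x H2) as [z [_ [H4 H5]]].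
    assert (Y : exists y, wo_lt y k /\ wo_lt (f y) d /\ le z (f y)).
    { apply NNPP; intros M; apply N; exists z; split; auto.
      intros y Hy Hfy; destruct (le_or_lt z (f y)); auto; exfalso; eauto 6. }
    destruct Y as [y [Y1 [Y2 Y3]]].
    exists (exist _ y Y1, c (f y) x); simpl; repeat split; auto.
    exact (lt_le_trans _ _ _ H4 Y3).
  - intros [x [H1 H2]] [x' [H1' H2']] [y w] [p [K1 K2]] [p' [K1' K2']]; simpl in *.
    apply sig_eq; simpl.
    apply (Hcc _ p); [split; auto|split; auto|congruence].
Qed.

(** * Club guessing *)

(** A witness against [cof_gt] at the least possible [k] also serves every larger [k], so one map
    per [a] is enough. *)
Lemma exists_cofinal_maps (L Lp : WO) :
  exists e : Lp -> L -> Lp, (forall a y, le (e a y) a) /\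
    forall a (k : L), ~ cof_gt k a -> forall x, wo_lt x a ->
      exists y, wo_lt y k /\ le x (e a y) /\ wo_lt (e a y) a.
Proof.
  cut (forall a : Lp, exists e : L -> Lp, (forall y, le (e y) a) /\
    forall k, ~ cof_gt k a -> forall x, wo_lt x a ->
      exists y, wo_lt y k /\ le x (e y) /\ wo_lt (e y) a).
  { intros H; destruct (choice _ _ _ H) as [e He]; exists e; split; intros a; apply He. }
  intros a; destruct (classic (exists k : L, ~ cof_gt k a)) as [H|H].
  - destruct (wo_least L _ H) as [k [Hk Hmin]].
    apply not_all_ex_not in Hk; destruct Hk as [f Hf].
    destruct (choice L Lp (fun y z => le z a /\ (wo_lt (f y) a -> z = f y))) as [e He].
    { intros y; destruct (classic (wo_lt (f y) a)) as [K|K].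
      - exists (f y); split; auto; exact (lt_le _ _ K).
      - exists a; split; [apply le_refl|contradiction]. }
    exists e; split; [intros y; apply He|].
    intros k' Hk' x Hx; apply NNPP; intros N; apply Hf; exists x; split; auto.
    intros y Hy Hya; destruct (le_or_lt x (f y)) as [K|K]; auto; exfalso.
    apply N; exists y; rewrite (proj2 (He y) Hya); repeat split; auto.
    exact (lt_le_trans _ _ _ Hy (Hmin k' Hk')).
  - exists (fun _ => a); split; [intros; apply le_refl|].
    intros k Hk; exfalso; eauto.
Qed.

Lemma nonincreasing_stabilizes (W : WO) (u : nat -> W) :
  (forall n, le (u (S n)) (u n)) -> exists N, forall n, N <= n -> u n = u N.
Proof.
  intros H.
  destruct (wo_least W (fun x => exists n, u n = x)) as [x [[N HN] Hmin]].
  { exists (u 0), 0; reflexivity. }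
  exists N; intros n Hn; apply le_antisym.
  - induction Hn; [apply le_refl|]. exact (le_trans _ _ _ (H m) IHHn).
  - rewrite HN; apply Hmin; exists n; reflexivity.
Qed.

(* The guessing sequence is [C_d = { P d l | l a list of points below eps d }]. *)
Theorem club_guessing (L Lp : WO) :
  is_cardinal L -> injects nat L -> uncountable_cof L -> is_succ_card L Lp ->
  exists (P : Lp -> list L -> Lp) (eps : Lp -> L),
    (forall d l, le (P d l) d) /\
    forall h : Lp -> Lp, exists d, forall k : L, exists l,
      Forall (fun y => wo_lt y (eps d)) l /\
      closed_under h (P d l) /\ cof_gt k (P d l).
Proof.
  intros Hc Hn Hu Hs.
  destruct (exists_cofinal_maps L Lp) as [e [He1 He2]].
  destruct (choice ((Lp -> Lp) * Lp) Lp (fun u m =>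
    closed_under (fst u) m /\ le m (snd u) /\
    forall z, closed_under (fst u) z -> le z (snd u) -> le z m)) as [mx Hmx].
  { intros [h g]; apply closed_under_max. }
  (* A list describes a walk down from [d]: at [a], the entry [y] leads to [e a y] and from there
     down to the nearest closed point of [h]. *)
  pose (P := fun h d (l : list L) => fold_left (fun a y => mx (h, e a y)) l d).
  assert (HP : forall h d l, le (P h d l) d).
  { intros h d l; revert d; induction l as [|y l IH]; intros d; [apply le_refl|].
    apply le_trans with (1 := IH _).
    apply le_trans with (2 := He1 d y); apply (Hmx (h, e d y)). }
  apply NNPP; intros N.
  (* If the walks through a club [h] with entries below [eps] do not guess, the pair is corrected by
     a club [h'] that they miss and by bounds [k] on the cofinalities they reach in it. Pointwise
     maxima make the corrections increase. *)
  assert (Hstep : forall s : (Lp -> Lp) * (Lp -> L), exists s' : (Lp -> Lp) * (Lp -> L),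
    (forall x, le (fst s x) (fst s' x)) /\ (forall d, le (snd s d) (snd s' d)) /\
    forall d l, Forall (fun y => wo_lt y (snd s d)) l ->
      closed_under (fst s') (P (fst s) d l) -> ~ cof_gt (snd s' d) (P (fst s) d l)).
  { intros [h eps]; simpl.
    apply NNPP; intros M; apply N; exists (P h), eps; split; auto.
    intros h'; apply NNPP; intros Q; apply M.
    assert (Q' : forall d, exists k : L, forall l, Forall (fun y => wo_lt y (eps d)) l ->
       closed_under h' (P h d l) -> ~ cof_gt k (P h d l)).
    { intros d; apply NNPP; intros Z; apply Q; exists d; intros k.
      apply NNPP; intros Z'; apply Z; exists k; intros l H1 H2 H3; eauto. }
    destruct (choice _ _ _ Q') as [k Hk].
    destruct (choice Lp Lp _ (fun x => wo_max Lp (h x) (h' x))) as [h2 Hh2].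
    destruct (choice Lp L _ (fun x => wo_max L (eps x) (k x))) as [k2 Hk2].
    exists (h2, k2); simpl; repeat split; try (intros; apply Hh2); try (intros; apply Hk2).
    intros d l H1 H2 H3; apply (Hk d l H1).
    - revert H2; apply closed_under_mono; intros x; apply Hh2.
    - revert H3; apply cof_gt_mono, Hk2. }
  destruct (choice _ _ _ Hstep) as [next Hnext].
  assert (HL : exists k0 : L, True) by (destruct Hn as [n _]; exists (n 0); auto).
  destruct HL as [k0 _].
  pose (st := fun n => Nat.iter n next (fun x : Lp => x, fun _ : Lp => k0)).
  pose (h := fun n => fst (st n)); pose (eps := fun n => snd (st n)).
  assert (Hh : forall n x, le (h n x) (h (S n) x)) by (intros n; apply (Hnext (st n))).
  assert (Heps : forall n d, le (eps n d) (eps (S n) d)) by (intros n; apply (Hnext (st n))).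
  assert (Hfail : forall n d l, Forall (fun y => wo_lt y (eps n d)) l ->
    closed_under (h (S n)) (P (h n) d l) -> ~ cof_gt (eps (S n) d) (P (h n) d l))
    by (intros n; apply (Hnext (st n))).
  clearbody h eps; clear st Hnext next Hstep N.
  assert (Heps' : forall n m d, n <= m -> le (eps n d) (eps m d)).
  { intros n m d H; induction H; [apply le_refl|eauto using le_trans]. }
  (* The closed points of [hw] belong to all clubs of the sequence. *)
  destruct (choice Lp Lp (fun x z => forall n, wo_lt (h n x) z)) as [hw Hhw].
  { intros x; apply (succ_card_families_bounded L Lp Hn Hs nat Hn (fun n => h n x)). }
  assert (Hclw : forall n d, closed_under hw d -> closed_under (h n) d).
  { intros n d; apply closed_under_mono; intros x; exact (lt_le _ _ (Hhw x n)). }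
  (* [d] is put above every [g k] because the right [k], the bound [ew] of all [eps n d], is known
     only after [d]. *)
  destruct (choice _ _ _ (exists_cof_gt L Lp Hc Hn Hu Hs hw)) as [g Hg].
  destruct (succ_card_families_bounded L Lp Hn Hs L (ex_intro _ _ (fun x y E => E)) g)
    as [d0 Hd0].
  destruct (closed_under_unbounded L Lp Hn Hs hw d0) as [d [Hd Hdcl]].
  assert (Hew : exists ew, forall n, wo_lt (eps n d) ew).
  { apply bounded_of_not_cofinal_range; intros C.
    apply (Hu _ C), injects_range. }
  destruct Hew as [ew Hew].
  destruct (Hg ew) as [Hgcl Hgcof].
  pose proof (wo_trans _ _ _ _ (Hd0 ew) Hd) as Hgd.
  set (gs := g ew) in *.
  (* The points that survive in all but finitely many of the approximations; the least
     one above [gs] has cofinality at most [ew], so it can be descended from. *)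
  pose (D := fun a => exists N, forall n, N <= n -> closed_under (h n) a /\
    exists l, Forall (fun y => wo_lt y (eps n d)) l /\ P (h n) d l = a).
  destruct (wo_least Lp (fun a => D a /\ le gs a)) as [a [[[N HN] Hga] Hmin]].
  { exists d; split; [|exact (lt_le _ _ Hgd)].
    exists 0; intros n _; split; auto; exists nil; auto. }
  assert (Hcof : ~ cof_gt (eps (S N) d) a).
  { destruct (HN N (le_n N)) as [_ [l [Hl1 Hl2]]].
    rewrite <- Hl2; apply Hfail; auto; rewrite Hl2; apply HN; lia. }
  destruct (le_cases _ _ Hga) as [E|Hlt].
  { apply Hcof; rewrite <- E; revert Hgcof; apply cof_gt_mono.
    exact (lt_le _ _ (Hew _)). }
  destruct (He2 a _ Hcof gs Hlt) as [y [Hy1 [Hy2 Hy3]]].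
  (* The clubs shrink as [n] grows, so the largest closed points up to [e a y] decrease and become
     constant. Their final value survives, is below [a], and is not below [gs], which is in every
     club: this contradicts the choice of [a]. *)
  destruct (nonincreasing_stabilizes Lp (fun n => mx (h n, e a y))) as [N' HN'].
  { intros n; apply (Hmx (h n, e a y)); [|apply (Hmx (h (S n), e a y))].
    apply closed_under_mono with (1 := Hh n), (Hmx (h (S n), e a y)). }
  set (a' := mx (h N', e a y)) in *.
  apply (Hmin a'); [split|].
  - exists (S N + N'); intros n Hnn; rewrite <- (HN' n) by lia; split.
    + apply (Hmx (h n, e a y)).
    + destruct (HN n) as [_ [l [Hl1 Hl2]]]; [lia|].
      exists (l ++ y :: nil); split.
      * apply Forall_app; split; auto; constructor; auto.
        apply (lt_le_trans _ _ _ Hy1), Heps'; lia.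
      * unfold P in *; rewrite fold_left_app; simpl; rewrite Hl2; reflexivity.
  - apply (Hmx (h N', e a y)); simpl; auto.
  - apply (le_lt_trans _ _ _ (proj1 (proj2 (Hmx (h N', e a y)))) Hy3).
Qed.

(** * Stepping down to a common point *)

(** This is the set [C(be,i)]. Bounding the list entries by [i] instead of [eps] keeps it small; it
    contains all of [C_d], for [d = e be j] with [j] below [i], once [i] is at least [eps d]. *)
Definition reach {L Lp : WO} (P : Lp -> list L -> Lp) (e : Lp -> L -> Lp)
  (be : Lp) (i : L) (x : Lp) : Prop :=
  exists j l, wo_lt j i /\ Forall (fun y => wo_lt y i) l /\ x = P (e be j) l.

Lemma Forall_sig (A : Type) (Q : A -> Prop) (l : list A) :
  Forall Q l -> exists l' : list {x | Q x}, map (@proj1_sig _ _) l' = l.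
Proof.
  induction 1 as [|x l Hx _ [l' <-]]; [exists nil; auto|].
  exists (exist _ x Hx :: l'); reflexivity.
Qed.

(* For [al] in the interval [(eta, d)] and [be] in the set [b], the point [d] is recovered
   from [al], [be] and [i] as the least point above [al] reachable from [be]. *)
Definition visible {L Lp : WO} (P : Lp -> list L -> Lp) (e : Lp -> L -> Lp)
  (i : L) (eta d : Lp) (b : Lp -> Prop) : Prop :=
  wo_lt eta d /\ forall be, b be ->
    wo_lt d be /\ reach P e be i d /\
    forall x, reach P e be i x -> wo_lt x d -> wo_lt x eta.

Lemma visible_stationary (L Lp : WO) (P : Lp -> list L -> Lp) (eps : Lp -> L)
  (e : Lp -> L -> Lp) (I : Type) (k0 : L) (B : (Lp -> Prop) -> Prop) :
  injects nat L -> uncountable_cof L ->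
  (forall d l, le (P d l) d) ->
  (forall h : Lp -> Lp, exists d, forall k : L, exists l,
      Forall (fun y => wo_lt y (eps d)) l /\
      closed_under h (P d l) /\ cof_gt k (P d l)) ->
  (forall d x, wo_lt x d -> exists j, e d j = x) ->
  injects I (below L k0) ->
  (forall f : I -> L, exists k, forall t, wo_lt (f t) k) ->
  (forall b, B b -> exists g : I -> Lp, forall x, b x <-> exists t, g t = x) ->
  (forall x, exists b, B b /\ forall be, b be -> wo_lt x be) ->
  forall h : Lp -> Lp, exists d i eta b, closed_under h d /\ B b /\ visible P e i eta d b.
Proof.
  intros Hn Hu HP Hguess He HI Hbd Hot Habove h.
  destruct (Hguess h) as [d0 Hd0].
  destruct (Habove d0) as [b [Hb Hd0b]].
  destruct (Hot b Hb) as [g Hg].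
  assert (Hgd : forall t, wo_lt d0 (g t)) by (intros t; apply Hd0b, Hg; eauto).
  destruct (choice _ _ _ (fun t => He (g t) d0 (Hgd t))) as [j Hj].
  destruct (Hbd j) as [k1 Hk1].
  destruct (wo_max L k0 k1) as [k2 [H02 [H12 _]]].
  destruct (wo_max L k2 (eps d0)) as [k3 [H23 [He3 _]]].
  (* [i] dominates the size of [I], the indices of [d0] in all enumerations [e (g t)], and
     [eps d0]. *)
  destruct (exists_infinite_below L Hn Hu k3) as [i [H3i Hi]].
  destruct (Hd0 i) as [l [Hl [Hcl Hcof]]].
  exists (P d0 l), i.
  assert (Hr : forall t, reach P e (g t) i (P d0 l)).
  { intros t; exists (j t), l; repeat split.
    - apply lt_le_trans with (1 := Hk1 t); eauto using le_trans.
    - revert Hl; apply Forall_impl; intros y Hy.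
      apply lt_le_trans with (1 := Hy); eauto using le_trans.
    - rewrite Hj; reflexivity. }
  (* Since [below L i] is infinite, no more than that many points are reached from a single [g t],
     and cofinality above [i] bounds those below [P d0 l]. Using the cofinality once more bounds
     these bounds over all [t]. *)
  assert (Hx : forall t, exists x, wo_lt x (P d0 l) /\
    forall y, reach P e (g t) i y -> wo_lt y (P d0 l) -> wo_lt y x).
  { intros t.
    destruct (cof_gt_family L Lp i (P d0 l) (below L i * list (below L i))
      (fun u => P (e (g t) (proj1_sig (fst u))) (map (@proj1_sig _ _) (snd u))) Hcof)
      as [x [Hx1 Hx2]].
    - apply injects_trans with (2 := injects_square_below L i Hi).
      apply injects_prod; [exists (fun x => x); auto|].
      apply injects_lists_below; auto.
    - exists x; split; auto.
      intros y (j' & l' & Hj' & Hl' & ->) Hy.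
      destruct (Forall_sig _ _ _ Hl') as [l2 <-].
      exact (Hx2 (exist _ j' Hj', l2) Hy). }
  destruct (choice _ _ _ Hx) as [x Hx'].
  destruct (cof_gt_family L Lp i (P d0 l) I x Hcof) as [eta [Heta1 Heta2]].
  { apply injects_trans with (1 := HI), injects_sub.
    intros y Hy; apply lt_le_trans with (1 := Hy); eauto using le_trans. }
  exists eta, b; split; [auto|split; [auto|split; [auto|]]].
  intros be Hbe; apply Hg in Hbe; destruct Hbe as [t <-].
  repeat split; auto.
  - exact (le_lt_trans _ _ _ (HP _ _) (Hgd t)).
  - intros y Hy Hyd; apply wo_trans with (x t).
    + apply (Hx' t); auto.
    + apply Heta2, (Hx' t).
Qed.

Lemma injects_le_succ_card (L Lp : WO) : injects nat L -> is_succ_card L Lp ->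
  forall x : Lp, injects {y | le y x} L.
Proof.
  intros Hn Hs x.
  destruct (closed_under_unbounded L Lp Hn Hs (fun y => y) x) as [z [Hz _]].
  apply injects_trans with (2 := proj2 (proj2 Hs) z), injects_sub.
  intros y Hy; exact (le_lt_trans _ _ _ Hy Hz).
Qed.

(* Fodor's lemma, a set being stationary when it contains closure points of every [h]. *)
Lemma stationary_piece (L Lp : WO) (G : L -> L -> Lp -> Lp -> Prop) (ga : Lp) :
  injects nat L -> is_succ_card L Lp ->
  (forall h : Lp -> Lp, exists d i j eta,
     closed_under h d /\ wo_lt eta d /\ (wo_lt ga d -> G i j eta d)) ->
  exists i j eta, forall h : Lp -> Lp, exists d,
    closed_under h d /\ wo_lt eta d /\ wo_lt ga d /\ G i j eta d.
Proof.
  intros Hn Hs HG; apply NNPP; intros N.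
  assert (Hbad : forall u : (L * L) * Lp, exists h : Lp -> Lp, forall d,
    closed_under h d -> wo_lt (snd u) d -> wo_lt ga d ->
    ~ G (fst (fst u)) (snd (fst u)) (snd u) d).
  { intros [[i j] eta]; simpl; apply NNPP; intros M; apply N; exists i, j, eta.
    intros h; apply NNPP; intros K; apply M; exists h; intros d H1 H2 H3 H4; eauto 7. }
  destruct (choice _ _ _ Hbad) as [hh Hhh].
  pose proof (injects_square L Hn) as Hsq.
  (* The diagonal intersection: a closed point [d] of [H] is closed under [hh ((i, j), eta)] for all
     [i], [j] and all [eta] below [d]. *)
  destruct (choice Lp Lp (fun x z => le ga z /\
    forall i j eta y, le eta x -> le y x -> wo_lt (hh ((i, j), eta) y) z)) as [H HH].
  { intros x.
    pose proof (injects_le_succ_card L Lp Hn Hs x) as Hle.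
    destruct (succ_card_families_bounded L Lp Hn Hs
      ((L * L) * ({y : Lp | le y x} * {y : Lp | le y x}))%type) with
      (f := fun u : (L * L) * ({y : Lp | le y x} * {y : Lp | le y x}) =>
         hh (fst u, proj1_sig (fst (snd u))) (proj1_sig (snd (snd u)))) as [z1 Hz1].
    { apply injects_trans with (2 := Hsq), injects_prod; auto.
      apply injects_trans with (2 := Hsq), injects_prod; auto. }
    destruct (wo_max Lp ga z1) as [z [H1 [H2 _]]]; exists z; split; auto.
    intros i j eta y He Hy.
    exact (lt_le_trans _ _ _ (Hz1 ((i, j), (exist _ eta He, exist _ y Hy))) H2). }
  destruct (HG H) as (d & i & j & eta & Hd & Heta & Hg).
  assert (Hga : wo_lt ga d) by exact (le_lt_trans _ _ _ (proj1 (HH eta)) (Hd _ Heta)).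
  apply (Hhh ((i, j), eta) d); simpl; auto.
  intros y Hy; destruct (wo_max Lp eta y) as [x [H1 [H2 H3]]].
  apply wo_trans with (H x); [apply HH; auto|].
  apply Hd; destruct H3 as [->| ->]; auto.
Qed.

(** * Families of small sets *)

(** If every member met the points up to [x], disjointness would inject the family into a set of
    size at most [L]. *)
Lemma good_family_above (L Lp X : WO) (s : X) (A : (Lp -> Prop) -> Prop) :
  injects nat L -> is_succ_card L Lp -> good_family Lp X s A ->
  forall x, exists a, A a /\ forall al, a al -> wo_lt x al.
Proof.
  intros Hn Hs [_ [Hdis [f [Hf _]]]] x.
  apply NNPP; intros N; apply (proj1 (proj2 Hs)).
  apply injects_trans with (2 := injects_le_succ_card L Lp Hn Hs x).
  apply injects_trans with (1 := ex_intro _ f Hf).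
  apply injects_of_rel with (R := fun a y => proj1_sig a (proj1_sig y)).
  - intros [a Ha]; apply NNPP; intros M; apply N; exists a; split; auto.
    intros al Hal; apply NNPP; intros K; apply M; exists (exist _ al K); auto.
  - intros [a Ha] [b Hb] y H1 H2; apply sig_eq, NNPP; intros K.
    exact (Hdis a b Ha Hb K _ (conj H1 H2)).
Qed.

(** All members have the same order type, so one empty member would make all of them empty and thus
    equal, while [x] and [y] yield two distinct ones. *)
Lemma good_family_nonempty (K X : WO) (s : X) (A : (K -> Prop) -> Prop) (x y : K) :
  wo_lt x y -> good_family K X s A -> forall a, A a -> exists z, a z.
Proof.
  intros Hxy [Hot [_ [f [Hf _]]]] a Ha.
  apply NNPP; intros N.
  destruct (Hot a Ha) as [ga _].
  assert (HE : forall b, A b -> b = fun _ => False).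
  { intros b Hb; extensionality z; apply propositional_extensionality.
    split; [intros Hz|tauto].
    destruct (Hot b Hb) as [gb [_ [Hgb _]]].
    destruct (Hgb (exist _ z Hz)) as [u _].
    apply N; exists (proj1_sig (ga u)); exact (proj2_sig (ga u)). }
  apply (lt_irrefl K x).
  replace y with x in Hxy; auto.
  apply Hf, sig_eq.
  rewrite (HE _ (proj2_sig (f x))), (HE _ (proj2_sig (f y))); reflexivity.
Qed.

Lemma good_family_range (K X : WO) (s : X) (A : (K -> Prop) -> Prop) :
  good_family K X s A ->
  forall a, A a -> exists g : below X s -> K, forall x, a x <-> exists t, g t = x.
Proof.
  intros [Hot _] a Ha; destruct (Hot a Ha) as [f [_ [Hf _]]].
  exists (fun t => proj1_sig (f t)); intros x; split.
  - intros Hx; destruct (Hf (exist _ x Hx)) as [t Ht]; exists t; rewrite Ht; reflexivity.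
  - intros [t <-]; exact (proj2_sig (f t)).
Qed.

Lemma good_family_sub (K X : WO) (s : X) (A A' : (K -> Prop) -> Prop) :
  good_family K X s A -> (forall a, A' a -> A a) -> injects K {a | A' a} ->
  good_family K X s A'.
Proof.
  intros [Hot [Hdis [f [Hf1 Hf2]]]] Hsub Hin; split; [auto|split; [auto|]].
  apply injects_antisym; auto.
  apply injects_trans with {a | A a}; [apply injects_sub; auto|].
  apply injects_of_rel with (R := fun a x => f x = a); [auto|congruence].
Qed.

Lemma unbounded_injects (L Lp : WO) (T : Lp -> Prop) :
  injects nat L -> is_succ_card L Lp ->
  (forall x, exists d, T d /\ wo_lt x d) -> injects Lp {d | T d}.
Proof.
  intros Hn Hs HT.
  destruct (injects_or_initial Lp {d | T d}) as [H|[t Ht]]; [exact H|exfalso].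
  destruct (succ_card_families_bounded L Lp Hn Hs {d | T d}
    (injects_trans _ _ _ Ht (proj2 (proj2 Hs) t)) (@proj1_sig _ _)) as [x Hx].
  destruct (HT x) as [d [Hd1 Hd2]].
  exact (lt_le _ _ Hd2 (Hx (exist _ d Hd1))).
Qed.

(** A proper segment of the cardinal [X] is smaller than the cofinality of [L]. *)
Lemma injects_initial_of_le_cf (X L : WO) (s : X) :
  is_cardinal X -> le_cf X L ->
  (exists k : L, injects (below X s) (below L k)) /\
  forall f : below X s -> L, exists k, forall t, wo_lt (f t) k.
Proof.
  intros HX Hcf; split.
  - destruct (injects_or_initial L (below X s)) as [H|H]; [exfalso|exact H].
    apply (HX s), injects_trans with (2 := H).
    refine (injects_trans _ _ _ (Hcf (fun _ => True) _) (injects_sig _ _)).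
    intros x; exists x; auto.
  - intros f; apply bounded_of_not_cofinal_range; intros C.
    apply (HX s), injects_trans with (1 := Hcf _ C), injects_range.
Qed.

(** * Transferring the colouring *)

Lemma exists_enumeration (L Lp : WO) : injects nat L -> is_succ_card L Lp ->
  exists e : Lp -> L -> Lp, forall d x, wo_lt x d -> exists j, e d j = x.
Proof.
  intros Hn [_ [_ Hb]].
  assert (H : forall d : Lp, exists e : L -> Lp, forall x, wo_lt x d -> exists j, e j = x).
  { intros d; destruct Hn as [n _].
    destruct (injection_on _ _ _ (n 0) (Hb d)) as [g Hg].
    destruct (choice L Lp (fun j z => forall x, wo_lt x d -> g x = j -> x = z)) as [e He].
    - intros j; destruct (classic (exists x, wo_lt x d /\ g x = j)) as [[x [Hx E]]|N].
      + exists x; intros y Hy E'; apply Hg; congruence.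
      + exists d; intros x Hx E; exfalso; eauto.
    - exists e; intros x Hx; exists (g x); symmetry; auto. }
  exact (choice _ _ _ H).
Qed.

Lemma exists_decoding (A B : Type) (a : A) : injects A B ->
  exists (code : A -> B) (dec : B -> A), forall x, dec (code x) = x.
Proof.
  intros [f Hf]; exists f.
  destruct (choice B A (fun y z => forall x, f x = y -> z = x)) as [g Hg].
  - intros y; destruct (classic (exists x, f x = y)) as [[x E]|N].
    + exists x; intros x' E'; apply Hf; congruence.
    + exists a; intros x E; exfalso; eauto.
  - exists g; auto.
Qed.

(* On [T] the indices are so sparse that [aa d < bb d'] forces [d < d']. *)
Lemma thinning (L Lp : WO) (aa bb : Lp -> Lp -> Prop) (Good : Lp -> Prop) (eta : Lp) :
  injects nat L -> is_succ_card L Lp ->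
  (forall d, exists z, forall y, aa d y \/ bb d y -> wo_lt y z) ->
  (forall h : Lp -> Lp, exists d, closed_under h d /\ Good d) ->
  (forall d, Good d -> wo_lt eta d /\ (forall y, aa d y \/ bb d y -> wo_lt d y) /\
     (exists y, aa d y) /\ (exists y, bb d y) /\ ~ set_lt Lp (aa d) (bb d)) ->
  exists T : Lp -> Prop, (forall d, T d -> Good d) /\
    injects Lp {a | exists d, T d /\ a = aa d} /\
    injects Lp {b | exists d, T d /\ b = bb d} /\
    forall d d', T d -> T d' -> set_lt Lp (aa d) (bb d') ->
      forall al, aa d al -> wo_lt eta al /\ wo_lt al d'.
Proof.
  intros Hn Hs Hbd Hstat HG.
  destruct (choice _ _ _ Hbd) as [k Hk].
  (* Closure under [k] puts the sets of every smaller index below [d], while the sets of index [d]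
     lie above [d]. *)
  pose (T := fun d => Good d /\ closed_under k d).
  assert (HT : injects Lp {d | T d}).
  { apply unbounded_injects with (1 := Hn) (2 := Hs); intros x.
    destruct (choice _ _ _ (fun y => wo_max Lp x (k y))) as [h Hh].
    destruct (Hstat h) as [d [H1 H2]]; exists d; split; [split; auto|].
    - revert H1; apply closed_under_mono; intros y; apply Hh.
    - exact (le_lt_trans _ _ _ (proj1 (Hh eta)) (H1 eta (proj1 (HG d H2)))). }
  assert (Hsep : forall d d' y, T d -> T d' -> wo_lt d d' ->
    (aa d y \/ bb d y) -> (aa d' y \/ bb d' y) -> False).
  { intros d d' y [H1 H2] [H1' H2'] H Hy Hy'.
    apply (lt_irrefl Lp y), wo_trans with d'.
    - apply wo_trans with (k d); auto.
    - apply HG; auto. }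
  exists T; split; [intros d [H _]; exact H|].
  split; [|split].
  - apply injects_trans with (1 := HT).
    exists (fun u => exist (fun a => exists d, T d /\ a = aa d) (aa (proj1_sig u))
      (ex_intro _ (proj1_sig u) (conj (proj2_sig u) eq_refl))).
    intros [d Hd] [d' Hd'] E; apply (f_equal (@proj1_sig _ _)) in E; simpl in E.
    apply sig_eq; simpl.
    destruct (HG d (proj1 Hd)) as (_ & _ & [y Hy] & _).
    assert (Hy' := Hy); rewrite E in Hy'.
    destruct (wo_total Lp d d') as [H|[H|H]]; auto; exfalso; eauto.
  - apply injects_trans with (1 := HT).
    exists (fun u => exist (fun a => exists d, T d /\ a = bb d) (bb (proj1_sig u))
      (ex_intro _ (proj1_sig u) (conj (proj2_sig u) eq_refl))).
    intros [d Hd] [d' Hd'] E; apply (f_equal (@proj1_sig _ _)) in E; simpl in E.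
    apply sig_eq; simpl.
    destruct (HG d (proj1 Hd)) as (_ & _ & _ & [y Hy] & _).
    assert (Hy' := Hy); rewrite E in Hy'.
    destruct (wo_total Lp d d') as [H|[H|H]]; auto; exfalso; eauto.
  - intros d d' [H1 H2] [H1' H2'] Hlt al Hal.
    destruct (HG d H1) as (G1 & G2 & _ & _ & G3).
    split; [exact (wo_trans _ _ _ _ G1 (G2 al (or_introl Hal)))|].
    destruct (wo_total Lp d d') as [H|[H|H]].
    + apply wo_trans with (k d); auto.
    + subst d'; contradiction.
    (* For [d'] below [d], the set [bb d'] would lie below [d] and hence below [aa d]. *)
    + exfalso.
      destruct (HG d' H1') as (_ & _ & _ & [y Hy] & _).
      apply (lt_irrefl Lp y), wo_trans with d; [apply wo_trans with (k d'); auto|].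
      apply wo_trans with al; auto.
Qed.

(** [e] and [nx] come before the families because the new coloring is built from them. [sel] serves
    both clauses: it returns [b] itself for the first, and a member of [A] above [d] for the second.
    That [sel d b] is not below [b] excludes [d = d'] in the final claim. *)
Lemma constant_step (L Lp X : WO) :
  singular L -> uncountable_cof L -> is_succ_card L Lp -> is_cardinal X -> le_cf X L ->
  exists (e : Lp -> L -> Lp) (nx : Lp -> Lp -> L -> Lp),
  (forall d x, wo_lt x d -> exists j, e d j = x) /\
  forall (s : X) (A B : (Lp -> Prop) -> Prop) (sel : Lp -> (Lp -> Prop) -> (Lp -> Prop)),
  good_family Lp X s A -> good_family Lp X s B ->
  (forall d b, B b -> A (sel d b)) ->
  (forall d b, B b -> (forall be, b be -> wo_lt d be) ->
     (forall al, sel d b al -> wo_lt d al) /\ ~ set_lt Lp (sel d b) b) ->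
  forall ga, exists (T : Lp -> Prop) (bb : Lp -> Lp -> Prop) (i j : L),
    (forall d, T d -> A (sel d (bb d)) /\ B (bb d) /\ e d j = ga) /\
    good_family Lp X s (fun a => exists d, T d /\ a = sel d (bb d)) /\
    good_family Lp X s (fun b => exists d, T d /\ b = bb d) /\
    forall d d', T d -> T d' -> set_lt Lp (sel d (bb d)) (bb d') ->
      forall al be, sel d (bb d) al -> bb d' be -> nx al be i = d'.
Proof.
  intros [Hc [Hn _]] Hu Hs HX Hcf.
  destruct (exists_enumeration L Lp Hn Hs) as [e He].
  destruct (club_guessing L Lp Hc Hn Hu Hs) as (P & eps & HP & Hguess).
  destruct (choice (Lp * Lp * L) Lp (fun u x =>
    let Q := fun y => reach P e (snd (fst u)) (snd u) y /\ wo_lt (fst (fst u)) y in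
    (exists y, Q y) -> Q x /\ forall y, Q y -> le x y)) as [nx Hnx].
  { intros [[al be] i]; simpl.
    destruct (classic (exists y, reach P e be i y /\ wo_lt al y)) as [H|H].
    - destruct (wo_least Lp _ H) as [x Hx]; exists x; auto.
    - exists al; contradiction. }
  exists e, (fun al be i => nx (al, be, i)); split; auto.
  intros s A B sel HA HB HselA Hsel ga.
  destruct (injects_initial_of_le_cf X L s HX Hcf) as [[k0 Hk0] Hbd].
  pose proof (visible_stationary L Lp P eps e (below X s) k0 B Hn Hu HP Hguess He Hk0 Hbd
    (good_family_range _ _ _ _ HB) (good_family_above _ _ _ _ _ Hn Hs HB)) as Hvis.
  destruct (stationary_piece L Lp (fun i j eta d =>
    (exists b, B b /\ visible P e i eta d b) /\ e d j = ga) ga Hn Hs) as (i & j & eta & Hst).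
  { intros h; destruct (Hvis h) as (d & i & eta & b & H1 & H2 & H3).
    (* An index [j] of [ga] is at hand only when [d] is above [ga]; elsewhere the second [i] is a
       dummy. *)
    destruct (classic (wo_lt ga d)) as [H|H].
    - destruct (He d ga H) as [j Hj]; exists d, i, j, eta.
      split; [auto|split; [apply H3|]]; eauto.
    - exists d, i, i, eta; split; [auto|split; [apply H3|]]; contradiction. }
  (* An arbitrary member of [B] is the default, so that [bb d] is in [B] for every [d], as the
     bounds for [thinning] require. *)
  destruct (choice Lp (Lp -> Prop) (fun d b => B b /\
    ((exists b', B b' /\ visible P e i eta d b') -> visible P e i eta d b))) as [bb Hbb].
  { intros d; destruct (classic (exists b, B b /\ visible P e i eta d b)) as [[b Hb]|H].
    - exists b; tauto.
    - destruct (good_family_above _ _ _ _ _ Hn Hs HB d) as [b [Hb _]].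
      exists b; tauto. }
  assert (Hbdd : forall A', good_family Lp X s A' -> forall a, A' a ->
    exists z, forall y, a y -> wo_lt y z).
  { intros A' HA' a Ha; destruct (good_family_range _ _ _ _ HA' a Ha) as [g Hg].
    destruct (succ_card_families_bounded L Lp Hn Hs _
      (injects_trans _ _ _ Hk0 (injects_sig _ _)) g) as [z Hz].
    exists z; intros y Hy; apply Hg in Hy; destruct Hy as [t <-]; auto. }
  destruct (closed_under_unbounded L Lp Hn Hs (fun x => x) ga) as [ga' [Hga _]].
  destruct (thinning L Lp (fun d => sel d (bb d)) bb (fun d => wo_lt eta d /\
    visible P e i eta d (bb d) /\ e d j = ga) eta Hn Hs) as (T & HT1 & HT2 & HT3 & HT4).
  - intros d; destruct (Hbb d) as [H1 _].
    destruct (Hbdd A HA _ (HselA d _ H1)) as [z1 Hz1], (Hbdd B HB _ H1) as [z2 Hz2].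
    destruct (wo_max Lp z1 z2) as [z [K1 [K2 _]]]; exists z.
    intros y [Hy|Hy]; eauto using lt_le_trans.
  - intros h; destruct (Hst h) as (d & H1 & H2 & H3 & H4 & H5).
    exists d; split; [auto|split; [auto|split; [apply Hbb; auto|auto]]].
  - intros d (H1 & H2 & H3); destruct (Hbb d) as [H4 _].
    assert (H5 : forall be, bb d be -> wo_lt d be) by (intros be Hbe; apply H2; auto).
    destruct (Hsel d _ H4 H5) as [H6 H7].
    split; [auto|split; [intros y [|]; auto|split; [|split; auto]]].
    + exact (good_family_nonempty _ _ _ _ _ _ Hga HA _ (HselA d _ H4)).
    + exact (good_family_nonempty _ _ _ _ _ _ Hga HB _ H4).
  - exists T, bb, i, j; split; [|split; [|split]].
    + intros d Hd; destruct (HT1 d Hd) as (_ & _ & H3), (Hbb d) as [H4 _]; auto.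
    + apply good_family_sub with (1 := HA); auto.
      intros a [d [_ ->]]; apply HselA, Hbb.
    + apply good_family_sub with (1 := HB); auto.
      intros b [d [_ ->]]; apply Hbb.
    + intros d d' Hd Hd' Hlt al be Hal Hbe.
      destruct (HT4 d d' Hd Hd' Hlt al Hal) as [K1 K2].
      destruct (HT1 d' Hd') as (_ & [_ Hv] & _); destruct (Hv be Hbe) as (_ & V2 & V3).
      destruct (Hnx (al, be, i)) as [[N1 N2] N3]; [exists d'; auto|]; simpl in *.
      apply le_antisym; [apply N3; auto|].
      (* A reached point below [d'] is below [eta] by visibility, hence below [al], whereas [nx]
         picks a point above [al]. *)
      intros K; apply (lt_irrefl Lp eta), wo_trans with al; auto.
      apply wo_trans with (1 := N2); auto.
Qed.

Theorem theorem3p6 (L Lp X : WO) :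
  singular L -> uncountable_cof L -> is_succ_card L Lp ->
  is_cardinal X -> le_cf X L ->
  forall c : Lp -> Lp -> L,
  exists cp : Lp -> Lp -> Lp,
  forall M : WO, is_cardinal M -> injects M L ->
  forall p : Lp -> Lp -> M,
    (pr1 Lp L X M p c -> pr1 Lp Lp X M p cp) /\
    (pr1_circ Lp L X M p c -> pr1_circ Lp Lp X M p cp).
Proof.
  intros HL Hu Hs HX Hcf c.
  destruct (constant_step L Lp X HL Hu Hs HX Hcf) as (e & nx & He & Hstep).
  destruct HL as [_ [Hn _]].
  assert (Hcode : injects (L * (L * L)) L).
  { pose proof (injects_square L Hn) as Hsq.
    apply injects_trans with (2 := Hsq), injects_prod; auto.
    exists (fun x => x); auto. }
  assert (Hl : exists l : L, True) by (destruct Hn as [n _]; exists (n 0); auto).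
  destruct Hl as [l0 _].
  destruct (exists_decoding _ _ (l0, (l0, l0)) Hcode) as (code & dec & Hdec).
  exists (fun al be => let u := dec (c al be) in
    e (e (nx al be (fst u)) (fst (snd u))) (snd (snd u))).
  intros M _ HM p.
  (* [tau] has at most [L] many values, so by regularity a single [ga] lies above them all and
     enumerates them. *)
  assert (Htau : forall tau : M -> Lp, exists ga, forall m, exists l, e ga l = tau m).
  { intros tau; destruct (succ_card_families_bounded L Lp Hn Hs M HM tau) as [ga Hga].
    exists ga; intros m; apply He, Hga. }
  split.
  - intros Hpr s A HA tau.
    destruct (Htau tau) as [ga Hga]; destruct (choice _ _ _ Hga) as [ep Hep].
    destruct (Hstep s A A (fun _ b => b) HA HA) with (ga := ga)
      as (T & bb & i & j & H1 & H2 & _ & H4); [auto| |].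
    { intros d b Hb Hdb; split; auto; intros K.
      destruct (closed_under_unbounded L Lp Hn Hs (fun x => x) d) as [d' [Hd' _]].
      destruct (good_family_nonempty _ _ _ _ _ _ Hd' HA b Hb) as [y Hy].
      exact (lt_irrefl Lp y (K y y Hy Hy)). }
    (* The first two components make the decoded outer index equal to [ga]; the third selects
       [tau m] in the enumeration of [ga]. *)
    destruct (Hpr s _ H2 (fun m => code (i, (j, ep m))))
      as (a & b & [d [Hd ->]] & [d' [Hd' ->]] & Hlt & Hcol).
    exists (bb d), (bb d'); split; [apply H1; auto|split; [apply H1; auto|split; auto]].
    intros al be Hal Hbe; rewrite (Hcol al be Hal Hbe), Hdec; simpl.
    rewrite (H4 d d' Hd Hd' Hlt al be Hal Hbe), (proj2 (proj2 (H1 d' Hd'))); apply Hep.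
  - (* The requirement on [A'] is monotone, so [A' = A] is the best choice. *)
    intros Hpr s A B HA HB; exists A; split; [auto|split; [apply HA|]]; intros tau.
    destruct (Htau tau) as [ga Hga]; destruct (choice _ _ _ Hga) as [ep Hep].
    destruct (choice (Lp * (Lp -> Prop)) (Lp -> Prop) (fun u a => A a /\
      (B (snd u) -> (forall be, snd u be -> wo_lt (fst u) be) ->
        (forall al, a al -> wo_lt (fst u) al) /\ ~ set_lt Lp a (snd u)))) as [sel Hsel].
    { intros [d b]; simpl.
      destruct (closed_under_unbounded L Lp Hn Hs (fun x => x) d) as [d' [Hd' _]].
      destruct (classic (B b)) as [Hb|Hb].
      - destruct (good_family_nonempty _ _ _ _ _ _ Hd' HB b Hb) as [y Hy].
        (* A member of [A] above both [d] and a point [y] of [b] cannot be below [b]. *)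
        destruct (wo_max Lp d y) as [z [K1 [K2 _]]].
        destruct (good_family_above _ _ _ _ _ Hn Hs HA z) as [a [Ha Haz]].
        exists a; repeat split; auto.
        + intros al Hal; exact (le_lt_trans _ _ _ K1 (Haz al Hal)).
        + intros K; destruct (good_family_nonempty _ _ _ _ _ _ Hd' HA a Ha) as [x Hx].
          apply K2, wo_trans with x; auto.
      - destruct (good_family_above _ _ _ _ _ Hn Hs HA d) as [a [Ha _]].
        exists a; split; auto; contradiction. }
    destruct (Hstep s A B (fun d b => sel (d, b)) HA HB) with (ga := ga)
      as (T & bb & i & j & H1 & H2 & H3 & H4).
    { intros d b _; apply Hsel. }
    { intros d b Hb Hdb; apply (Hsel (d, b)); auto. }
    destruct (Hpr s _ _ H2 H3) as (A' & HA' & _ & Hcol').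
    destruct (Hcol' (fun m => code (i, (j, ep m))))
      as (a & b & Ha & [d' [Hd' ->]] & Hlt & Hcol).
    destruct (HA' a Ha) as [d [Hd ->]].
    exists (sel (d, bb d)), (bb d');
      split; [apply (H1 d Hd)|split; [apply (H1 d' Hd')|split; auto]].
    intros al be Hal Hbe; rewrite (Hcol al be Hal Hbe), Hdec; simpl.
    rewrite (H4 d d' Hd Hd' Hlt al be Hal Hbe), (proj2 (proj2 (H1 d' Hd'))); apply Hep.
Qed.
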